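(* $\mathfrak{r}\leq\mathfrak{r}(2)\leq\mathfrak{r}(\mathcal{NC})\leq\mathfrak{r}_\sigma$.
   Context: For $A\subseteq\omega\times\omega$ and $n<\omega$ let $A(n)=\{m<\omega:(n,m)\in A\}$. A family $\mathcal{X}\subseteq[\omega]^\omega$ is centered if $\bigcap F$ is infinite for every finite nonempty $F\subseteq\mathcal{X}$. $\mathcal{NC}=\{A\subseteq\omega\times\omega:\ \text{for every } X\in[\omega]^\omega \text{ the family } \{A(n):n\in X\}\text{ is not centered}\}$, an ideal on $\omega\times\omega$, with $\mathcal{NC}^+=\mathcal{P}(\omega\times\omega)\setminus\mathcal{NC}$. For $A,B\in\mathcal{NC}^+$, $A$ splits $B$ if $A\cap B\in\mathcal{NC}^+$ and $B\setminus A\in\mathcal{NC}^+$. $\mathfrak{r}(\mathcal{NC})$ is the least size of $\mathcal{R}\subseteq\mathcal{NC}^+$ such that no element of $\mathcal{NC}^+$ splits all elements of $\mathcal{R}$. $\mathfrak{r}$ is the usual reaping number. $\mathfrak{r}(2)$ is the reaping number of the Boolean algebra $\mathcal{P}(\omega)/\mathrm{fin}\oplus\mathcal{P}(\omega)/\mathrm{fin}$ (free product; equivalently the clopen algebra of $(\beta\omega\setminus\omega)^2$): the least size of a set $R$ of nonzero elements such that no element $b$ splits all members of $R$ (where $b$ splits $r$ if $r\wedge b\ne0$ and $r\wedge -b\neq0$). A family $\mathcal{R}\subseteq[\omega]^\omega$ is $\sigma$-reaping if for every countable $\{X_n:n<\omega\}\subseteq[\omega]^\omega$ there is $A\in\mathcal{R}$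 such that for every $n$, either $A\subseteq^* X_n$ or $|A\cap X_n|<\omega$; $\mathfrak{r}_\sigma$ is the least size of a $\sigma$-reaping family. *)

(* Defs.v *)
From HB Require Import structures.
From mathcomp Require Import all_boot all_order.
From mathcomp Require Import boolp classical_sets functions cardinality filter.
From mathcomp Require Import topology.

Set Implicit Arguments.
Unset Strict Implicit.
Unset Printing Implicit Defensive.

Local Open Scope classical_set_scope.
Local Open Scope card_scope.

(* A cardinal is represented by a set of that size, and cardinals are compared
   with [#<=].  [least_size W] is a member of [W] of least size; by
   [least_sizeP] the default value is used only when [W] is empty. *)
Definition is_least_size (T : Type) (W : set (set T)) (R : set T) : Prop :=
  W R /\ forall S, W S -> R #<= S.

Definition least_size (T : Type) (W : set (set T)) : set T :=
  xget set0 (is_least_size W).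

Lemma ex_least_size (T : Type) (W : set (set T)) :
  W !=set0 -> exists R, is_least_size W R.
Proof.
move=> [S0 WS0].
pose P (F : set (set T -> T)) := forall S, W S ->
  (forall f, F f -> S (f S)) /\
  (forall f g, F f -> F g -> f S = g S -> f = g).
have [|F [PF maxF]] := @Zorn_bigcup _ P.
  move=> G GP totG S WS; split=> [f [H GH Hf]|f g [H GH Hf] [K GK Kg]].
    by have [+ _] := GP _ GH S WS; apply.
  have [HK|KH] := totG _ _ GH GK.
    by have [_ +] := GP _ GK S WS; apply=> //; exact: HK.
  by have [_ +] := GP _ GH S WS; apply=> //; exact: KH.
have [[R [WR RF]]|noR] :=
    pselect (exists R, W R /\ R `<=` (fun f => f R) @` F).
  exists R; split=> // S WS.
  have inj Q : W Q -> {in F &, injective (fun f : set T -> T => f Q)}.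
    by move=> WQ f g /set_mem Ff /set_mem Fg; apply: (PF Q WQ).2.
  apply: (card_le_trans (subset_card_le RF)).
  rewrite (card_le_eql (inj_card_eq (inj R WR))).
  rewrite -(card_le_eql (inj_card_eq (inj S WS))).
  by apply: subset_card_le => _ [f Ff <-]; exact: (PF S WS).1.
have /choice[h hP] : forall S, exists x,
    W S -> S x /\ ~ ((fun f => f S) @` F) x.
  move=> S; have [WS|nWS] := pselect (W S); last first.
    have [WF|] := pselect (exists x : T, True).
      by have [x _] := WF; exists x.
    move=> noT; exfalso; apply: noR; exists S0; split=> // x.
    by exfalso; apply: noT; exists x.
  apply: contrapT => nx; apply: noR; exists S; split=> // x Sx.
  by apply: contrapT => nFx; apply: nx; exists x.
have Fh : ~ F h by move=> Fh; have [_] := hP _ WS0; apply; exists h.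
exfalso; apply: (maxF (F `|` [set h])); last first.
  move=> S WS; have [Sh nh] := hP _ WS; split=> [f [|->//]|f g].
    exact: (PF S WS).1.
  move=> [Ff|->] [Fg|->] // fg; first exact: (PF S WS).2 fg.
    by exfalso; apply: nh; exists f.
  by exfalso; apply: nh; exists g.
by split=> [f|]; [left|move=> /(_ h) H; apply: Fh; apply: H; right].
Qed.

Lemma least_sizeP (T : Type) (W : set (set T)) :
  W !=set0 -> is_least_size W (least_size W).
Proof. by move=> /ex_least_size ?; exact: xgetPex. Qed.

Definition splits (S A : set nat) : Prop :=
  infinite_set (A `&` S) /\ infinite_set (A `\` S).

Definition reaping (R : set (set nat)) : Prop :=
  (forall A, R A -> infinite_set A) /\
  ~ exists2 S, infinite_set S & forall A, R A -> splits S A.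

Definition reaping_number : set (set nat) := least_size reaping.

Definition almost_subset (A B : set nat) : Prop := finite_set (A `\` B).

Definition sigma_reaping (R : set (set nat)) : Prop :=
  (forall A, R A -> infinite_set A) /\
  forall X : nat -> set nat, (forall n, infinite_set (X n)) ->
    exists2 A, R A &
      forall n, almost_subset A (X n) \/ finite_set (A `&` X n).

Definition sigma_reaping_number : set (set nat) := least_size sigma_reaping.

(* Taking F to be a singleton, every member of a centered family is
   infinite. *)
Definition centered (X : set (set nat)) : Prop :=
  forall F : set (set nat), finite_set F -> F !=set0 -> F `<=` X ->
    infinite_set (\bigcap_(A in F) A).

(* [xsection A n] is the vertical section A(n) = {m | (n, m) in A}. *)
Definition NC : set (set (nat * nat)) :=
  [set A | forall X : set nat, infinite_set X -> ~ centered (xsection A @` X)].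

Definition NCpos : set (set (nat * nat)) := ~` NC.

Definition NC_splits (A B : set (nat * nat)) : Prop :=
  NCpos (A `&` B) /\ NCpos (B `\` A).

Definition NC_reaping (R : set (set (nat * nat))) : Prop :=
  R `<=` NCpos /\
  ~ exists2 A, NCpos A & forall B, R B -> NC_splits A B.

Definition NC_reaping_number : set (set (nat * nat)) := least_size NC_reaping.

Record omega_star := OmegaStar {
  ultra :> set_system nat ;
  ultra_ultrafilter : UltraFilter ultra ;
  ultra_nonprincipal : forall n : nat, ultra <> principal_filter n }.

HB.instance Definition _ := gen_eqMixin omega_star.
HB.instance Definition _ := gen_choiceMixin omega_star.

Definition star (A : set nat) : set omega_star := [set U : omega_star | ultra U A].

Lemma star_cover : \bigcup_(A in [set: set nat]) star A = setT.
Proof.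
apply/seteqP; split=> // U _; exists setT => //.
by have := ultra_ultrafilter U => ?; exact: filterT.
Qed.

Lemma star_join (A B : set nat) (U : omega_star) :
  [set: set nat] A -> [set: set nat] B -> star A U -> star B U ->
  exists C, [/\ [set: set nat] C, star C U & star C `<=` star A `&` star B].
Proof.
move=> _ _ UA UB; exists (A `&` B); split=> //.
  by have := ultra_ultrafilter U => ?; exact: filterI.
move=> V VAB; have := ultra_ultrafilter V => ?.
by split; apply: filterS VAB => ? [].
Qed.

HB.instance Definition _ :=
  isBaseTopological.Build omega_star star_cover star_join.

(* The Boolean algebra is the algebra of clopen subsets of
   [omega_star * omega_star] with the product topology; its zero is the empty
   set and its operations are those of sets.  By Stone duality it is the free
   product of two copies of P(omega)/fin. *)
Definition clopen_splits (B A : set (omega_star * omega_star)) : Prop :=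
  A `&` B <> set0 /\ A `&` ~` B <> set0.

Definition reaping2 (R : set (set (omega_star * omega_star))) : Prop :=
  (forall A, R A -> clopen A /\ A <> set0) /\
  ~ exists2 B, clopen B & forall A, R A -> clopen_splits B A.

Definition reaping2_number : set (set (omega_star * omega_star)) :=
  least_size reaping2.

(* Main.v *)
Require Import Defs.
From mathcomp Require Import all_boot boolp classical_sets functions.
From mathcomp Require Import cardinality filter topology.

(* For r <= r(2), every nonempty clopen subset of the square of omega^* contains
   a box X^* x Y^*, and a set splitting all the X's yields a clopen cylinder
   splitting all the given clopen sets.

   For r(2) <= r(NC), a set B is NC-positive iff there are an infinite X and a
   free ultrafilter containing all the sections B(n), n in X.  Replace B by the
   countably many boxes X^* x Y_k^*, where Y_k is the intersection of the B(n)
   with n in X and n < k.  A clopen set C is a finite union of boxes, so it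
   consists of the pairs (U, V) whose iterated product contains some fixed
   A included in omega x omega.  If C splits all these boxes, compactness gives
   one point of C (and one of its complement) in X^* x Y_k^* for all k at once,
   and the two points show that A splits B.

   For r(NC) <= r_sigma, take the rectangles S x T with S and T in a
   sigma-reaping family: given C, choose T deciding every section of C, then S
   deciding the set of n such that T is almost contained in C(n).

   The last two families have the size of the original one because infinite
   cardinals are equal to their squares. *)

Set Implicit Arguments.
Unset Strict Implicit.
Unset Printing Implicit Defensive.

Local Open Scope classical_set_scope.
Local Open Scope card_scope.

(** * Cardinal arithmetic *)

Lemma card_le_of_inj T U (A : set T) (B : set U) (f : T -> U) :
  (forall x, A x -> B (f x)) ->
  (forall x y, A x -> A y -> f x = f y -> x = y) -> A #<= B.
Proof.
move=> AB finj.
have [g] : $|{injfun A >-> B}|.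
  apply/injfunPex; exists f => //.
  by move=> x y /set_mem Ax /set_mem Ay; exact: finj.
exact: inj_card_le g.
Qed.

Lemma inj_of_card_le T U (A : set T) (B : set U) : U -> A #<= B ->
  exists f : T -> U, (forall x, A x -> B (f x)) /\
    (forall x y, A x -> A y -> f x = f y -> x = y).
Proof.
move: B; elim/Ppointed: U => U B u; first by case: (no u).
move=> /pcard_leP/injfunPex[f AB finj]; exists f; split=> // x y Ax Ay.
by apply: finj; exact: mem_set.
Qed.

Lemma card_le_total T (A B : set T) : A #<= B \/ B #<= A.
Proof.
have [|R [[->|->] le]] := @ex_least_size T [set A; B]; first by exists A; left.
  by left; apply: le; right.
by right; apply: le; left.
Qed.

(** * Infinite cardinals are idempotent, by Zorn's lemma *)

Section Hessenberg.
Variables (T : Type) (R : set T).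

(** The diagonal of a graph encodes its underlying set, so Zorn's lemma can be applied to graphs
    alone, ordered by inclusion. *)
Let field (G : set (T * T * T)) (u : T) := exists z, G (u, u, z).

(* [G] is the graph of an injection from [field G `*` field G] into
   [field G]. *)
Let square_inj (G : set (T * T * T)) :=
  [/\ forall u v z, G (u, v, z) -> [/\ field G u, field G v & field G z],
      forall u v, field G u -> field G v -> exists z, G (u, v, z),
      forall u v z z', G (u, v, z) -> G (u, v, z') -> z = z',
      forall u v u' v' z, G (u, v, z) -> G (u', v', z) -> u = u' /\ v = v' &
      (exists t1 t2, [/\ field G t1, field G t2 & t1 <> t2]) /\
      field G `<=` R].

(** A copy of [nat] inside [R] carries the pairing function [pickle]. *)
Let square_inj_nat : infinite_set R -> exists G, square_inj G.
Proof.
move=> /infiniteP leR.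
have [t _] : R !=set0 by apply: infinite_setN0; exact/infiniteP.
have [g [gR ginj]] := inj_of_card_le t leR.
exists [set p | exists i j, p = (g i, g j, g (pickle (i, j)))].
set G := (X in square_inj X).
have fieldG i : field G (g i) by exists (g (pickle (i, i))), i, i.
have gI i j : g i = g j -> i = j by exact: ginj.
split.
- by move=> u v z [i [j [-> -> ->]]]; split; exact: fieldG.
- move=> u v [_ [i [_ [-> _ _]]]] [_ [j [_ [-> _ _]]]].
  by exists (g (pickle (i, j))), i, j.
- by move=> u v z z' [i [j [-> -> ->]]] [k [l [/gI-> /gI-> ->]]].
- move=> u v u' v' z [i [j [-> -> ->]]] [k [l [-> ->]]].
  by move=> /gI /(pcan_inj pickleK) [-> ->].
- split; last by move=> _ [_ [i [_ [-> _ _]]]]; exact: gR.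
  by exists (g 0), (g 1); split; [exact: fieldG..|move=> /gI].
Qed.

Let square_inj_bigcup (F : set (set (T * T * T))) : F !=set0 ->
  F `<=` square_inj -> total_on F subset -> square_inj (\bigcup_(G in F) G).
Proof.
move=> [G0 FG0] FP tot.
have fieldS G u : F G -> field G u -> field (\bigcup_(G in F) G) u.
  by move=> FG [z Gz]; exists z, G.
have max G H : F G -> F H -> exists K, [/\ F K, G `<=` K & H `<=` K].
  by move=> FG FH; have [GH|HG] := tot _ _ FG FH; [exists H|exists G]; split.
split.
- move=> u v z [G FG]; have [P1 _ _ _ _] := FP _ FG.
  by move=> /P1[? ? ?]; split; exact: fieldS FG _.
- move=> u v [z [G FG Gz]] [w [H FH Hw]]; have [K [FK GK HK]] := max _ _ FG FH.
  have [_ P2 _ _ _] := FP _ FK.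
  have [||x Kx] := P2 u v; [by exists z; exact: GK|by exists w; exact: HK|].
  by exists x, K.
- move=> u v z z' [G FG Gz] [H FH Hz]; have [K [FK GK HK]] := max _ _ FG FH.
  have [_ _ P3 _ _] := FP _ FK.
  by apply: P3; [exact: GK Gz|exact: HK Hz].
- move=> u v u' v' z [G FG Gz] [H FH Hz]; have [K [FK GK HK]] := max _ _ FG FH.
  have [_ _ _ P4 _] := FP _ FK.
  by apply: P4; [exact: GK Gz|exact: HK Hz].
- have [_ _ _ _ [[t1 [t2 [? ? t12]]] _]] := FP _ FG0.
  split; first by exists t1, t2; split=> //; exact: fieldS FG0 _.
  move=> u [z [G FG Gz]]; have [_ _ _ _ [_ +]] := FP _ FG.
  by apply; exists z.
Qed.

Let square_inj_max : infinite_set R ->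
  exists G, square_inj G /\ forall H, G `<` H -> ~ square_inj H.
Proof.
move=> Rinf.
have [|G [[G0|PG] maxG]] :=
    @Zorn_bigcup _ [set G | G = set0 \/ square_inj G].
- move=> F FP tot.
  have [[G [FG PG]]|nF] := pselect (exists G, F G /\ square_inj G); last first.
    left; rewrite -subset0 => p [G FG Gp].
    have [G0|PG] := FP _ FG; first by rewrite G0 in Gp.
    by apply: nF; exists G.
  right; suff -> : \bigcup_(X in F) X = \bigcup_(X in F `&` square_inj) X.
    apply: square_inj_bigcup; [by exists G|by move=> ? []|].
    by move=> X Y [FX _] [FY _]; exact: tot.
  apply/seteqP; split=> p [X]; last by move=> [FX _] Xp; exists X.
  move=> FX Xp; exists X => //; split=> //.
  by have [X0|//] := FP _ FX; rewrite X0 in Xp.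
- have [H PH] := square_inj_nat Rinf; exfalso.
  apply: (maxG H); last by right.
  rewrite G0; split=> // H0.
  have [_ _ _ _ [[t1 [_ [[z Hz] _ _]]] _]] := PH.
  by have := H0 _ Hz.
- by exists G; split=> // H GH PH; apply: (maxG H) => //; right.
Qed.

Lemma card_le_square : infinite_set R -> R `*` R #<= R.
Proof.
move=> /square_inj_max[G [[P1 P2 P3 P4 [[t1 [t2 [Et1 Et2 t12]]] ER]] maxG]].
set E := field G in P1 P2 Et1 Et2 ER *.
have /choice[f fP] : forall p : T * T, exists z, E p.1 -> E p.2 -> G (p, z).
  move=> [u v] /=; have [[Eu Ev]|nE] := pselect (E u /\ E v).
    by have [z Gz] := P2 u v Eu Ev; exists z.
  by exists u => Eu Ev; exfalso; apply: nE.
have fE u v : E u -> E v -> E (f (u, v)).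
  by move=> Eu Ev; have /P1[] := fP (u, v) Eu Ev.
have fI u v u' v' : E u -> E v -> E u' -> E v' -> f (u, v) = f (u', v') ->
    u = u' /\ v = v'.
  move=> Eu Ev Eu' Ev' ff; have Gz := fP (u, v) Eu Ev.
  by have := fP (u', v') Eu' Ev'; rewrite -ff; exact: P4 Gz.
(* [E] absorbs any disjoint set [D] with an injection [h : D -> E]: tag the
   points of [E] with [t1] and those of [D] with [t2]. *)
have absorb D h : (forall x, D x -> ~ E x) -> (forall x, D x -> E (h x)) ->
    (forall x y, D x -> D y -> h x = h y -> x = y) ->
    exists s, (forall x, (E `|` D) x -> E (s x)) /\
      (forall x y, (E `|` D) x -> (E `|` D) y -> s x = s y -> x = y).
  move=> DE hE hI.
  exists (fun x => if pselect (E x) then f (t1, x) else f (t2, h x)).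
  split=> [x EDx|x y EDx EDy].
    case: pselect => [Ex|nEx]; first exact: fE.
    by case: EDx => // Dx; apply: fE => //; exact: hE.
  case: pselect => [Ex|nEx]; case: pselect => [Ey|nEy].
  - by move=> /fI[].
  - case: EDy => // Dy /fI[]//; exact: hE.
  - case: EDx => // Dx /fI[]//; [exact: hE|by move=> ?; exfalso; apply: t12].
  - case: EDx => // Dx; case: EDy => // Dy /fI[]; rewrite -/E//; try exact: hE.
    by move=> _; exact: hI.
have [/(inj_of_card_le t1)[h [hE hI]]|/(inj_of_card_le t1)[k [kR kI]]] :=
    card_le_total (R `\` E) E.
  have [|||s [sE sI]] := absorb (R `\` E) h => //; first by move=> x [].
  have RED : R `<=` E `|` (R `\` E).
    by move=> x Rx; have [Ex|nEx] := pselect (E x); [left|right].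
  apply: (@card_le_of_inj _ _ _ _ (fun p => f (s p.1, s p.2))).
    by move=> [u v] [Ru Rv]; apply/ER/fE; apply/sE/RED.
  move=> [u v] [u' v'] [/RED Ru /RED Rv] [/RED Ru' /RED Rv'] /=.
  move=> /fI[]; try exact: sE.
  by move=> /sI-> // /sI->.
have /choice[h hP] : forall y, exists x, (k @` E) y -> E x /\ k x = y.
  move=> y; have [[x Ex xy]|nE] := pselect ((k @` E) y); first by exists x.
  by exists y => /nE.
have [|||s [sE sI]] := absorb (k @` E) h.
- by move=> _ [x Ex <-]; have [] := kR _ Ex.
- by move=> y /hP[].
- by move=> x y /hP[_ xh] /hP[_ yh] hxy; rewrite -xh -yh hxy.
set ED := E `|` _ in sE sI.
pose N := [set p : T * T * T | [/\ ED p.1.1, ED p.1.2,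
  ~ (E p.1.1 /\ E p.1.2) & p.2 = k (f (s p.1.1, s p.1.2))]].
have kE x : E x -> ~ E (k x) by move=> /kR[].
have kED x : E x -> ED (k x) by move=> Ex; right; exists x.
have fsE u v : ED u -> ED v -> E (f (s u, s v)) by move=> /sE ? /sE; exact: fE.
have fieldN : field (G `|` N) = ED.
  apply/seteqP; split=> [u [z [Gz|[]//]]|u].
    by left; exists z.
  move=> EDu; have [[z Gz]|nEu] := pselect (E u); first by exists z; left.
  by exists (k (f (s u, s u))); right; split=> // -[].
exfalso; apply: (maxG (G `|` N)); first split.
- by left.
- move=> NG; have /NG/P1[] : (G `|` N) (k t1, k t1, k (f (s (k t1), s (k t1)))).
    by right; split=> //=; [exact: kED..|move=> [+ _]; exact: kE].
  by move=> + _ _; exact: kE.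
- split; rewrite ?fieldN.
  + move=> u v z [/P1[? ? ?]|[/= EDu EDv _ ->]]; first by split; left.
    by split=> //; apply: kED; exact: fsE.
  + move=> u v EDu EDv; have [[Eu Ev]|nE] := pselect (E u /\ E v).
      by have [z Gz] := P2 u v Eu Ev; exists z; left.
    by exists (k (f (s u, s v))); right.
  + move=> u v z z' [Gz|[/= EDu EDv nE ->]] [Gz'|[/= _ _ nE' ->]] //.
    * exact: P3 Gz Gz'.
    * by have [? ? _] := P1 _ _ _ Gz; exfalso; apply: nE'.
    * by have [? ? _] := P1 _ _ _ Gz'; exfalso; apply: nE.
  + move=> u v u' v' z [Gz|[/= EDu EDv nE ->]] [Gz'|[/= EDu' EDv' nE' zE]].
    * exact: P4 Gz Gz'.
    * have [_ _] := P1 _ _ _ Gz; rewrite zE => Ez.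
      by exfalso; apply: kE Ez; exact: fsE.
    * have [_ _ Ez] := P1 _ _ _ Gz'.
      by exfalso; apply: kE Ez; exact: fsE.
    * have := kI _ _ (fsE _ _ EDu EDv) (fsE _ _ EDu' EDv') zE.
      by move=> /fI[]; try exact: sE; move=> /sI-> // /sI->.
  + split; first by exists t1, t2; split=> //; left.
    by move=> u [/ER//|[x Ex <-]]; have [] := kR _ Ex.
Qed.

End Hessenberg.

(** * Splitting countably many sets *)

Lemma infinite_natP (A : set nat) :
  infinite_set A <-> forall n, exists2 m, n <= m & A m.
Proof.
split=> [Ainf n|Aunb /finite_seqP[s As]].
  have [m [Am nm]] := infinite_setN0 (infinite_setD Ainf (finite_II n)).
  by exists m => //; rewrite leqNgt; apply/negP.
have [m] := Aunb (\max_(i <- s) i).+1.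
rewrite As => sm /= ms; move: sm; rewrite ltnNge => /negP; apply.
by rewrite (big_rem _ ms) leq_maxl.
Qed.

(* The splitting set is a union of alternate intervals of a partition of [nat]
   whose intervals eventually meet every [A i]. *)
Lemma exists_splitting_seq (A : nat -> set nat) :
  (forall i, infinite_set (A i)) -> exists S, forall i, splits S (A i).
Proof.
move=> Ainf.
have /choice[a aP] : forall p : nat * nat, exists m, p.2 <= m /\ A p.1 m.
  move=> [i n]; have /infinite_natP/(_ n)[m ? ?] := Ainf i.
  by exists m.
(* The interval from [n] to [next n] contains [a (i, n)] for every [i <= n]. *)
pose next n := (n + \max_(i < n.+1) a (val i, n)).+1.
pose N k := iter k next 0.
have a_next i n : i <= n -> n <= a (i, n) < next n.
  move=> i_n; have [-> _] := aP (i, n); rewrite /next ltnS /=.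
  apply: leq_trans (leq_addl _ _).
  have i_n1 : i < n.+1 by [].
  exact: (@leq_bigmax _ (fun j : 'I_n.+1 => a (val j, n)) (Ordinal i_n1)).
have N_mono : {homo N : k l / k <= l}.
  apply: homo_leq => //; first exact: leq_trans.
  by move=> k; rewrite /N /= /next -addnS leq_addr.
have N_ge k : k <= N k.
  by elim: k => // k IH; rewrite /N /= /next ltnS (leq_trans IH)// leq_addr.
exists [set m | exists k, N k.*2 <= m < N k.*2.+1] => i.
have large n : exists k, i <= k.*2 /\ n <= k.*2.
  exists (maxn i n); have := leq_addr (maxn i n) (maxn i n).
  by rewrite addnn geq_max => /andP.
split; apply/infinite_natP => n; have [k [ik nk]] := large n.
- have aN := a_next i (N k.*2) (leq_trans ik (N_ge _)).
  exists (a (i, N k.*2)).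
    by case/andP: aN => + _; apply: leq_trans; exact: leq_trans nk (N_ge _).
  by split; [exact: (aP (i, N k.*2)).2|exists k].
(* The next interval, of odd index, lies outside the splitting set and supplies the points of the
   difference. *)
- have /(leq_trans ik) ik1 := leqnSn k.*2.
  have /(leq_trans nk) nk1 := leqnSn k.*2.
  have /andP[aN1 aN2] := a_next i (N k.*2.+1) (leq_trans ik1 (N_ge _)).
  exists (a (i, N k.*2.+1)).
    by apply: leq_trans aN1; exact: leq_trans nk1 (N_ge _).
  split; first exact: (aP (i, N k.*2.+1)).2.
  move=> [l /andP[]]; have [lk|kl] := leqP l k.
    move=> _; rewrite ltnNge (leq_trans _ aN1)//.
    by apply: N_mono; rewrite ltnS leq_double.
  rewrite leqNgt (leq_trans aN2)//.
  by apply: (N_mono k.*2.+2); rewrite -doubleS leq_double.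
Qed.

Lemma exists_splitting I (D : set I) (X : I -> set nat) : finite_set D ->
  (forall i, D i -> infinite_set (X i)) ->
  exists2 S, infinite_set S & forall i, D i -> splits S (X i).
Proof.
move=> /finite_set_countable/(inj_of_card_le 0)[c [_ cinj]] Xinf.
(* Numbers that code no index of [D] get the default [setT], which is infinite as well. *)
have /choice[A AP] : forall n, exists B : set nat,
    infinite_set B /\ forall i, D i -> c i = n -> B = X i.
  move=> n; have [[i [Di cin]]|nD] := pselect (exists i, D i /\ c i = n).
    exists (X i); split=> [|j Dj cjn]; first exact: Xinf.
    by congr X; apply: cinj => //; rewrite cin.
  exists setT; split=> [|i Di cin]; first exact: infinite_nat.
  by exfalso; apply: nD; exists i.
have [S SA] := exists_splitting_seq (fun n => (AP n).1).
exists S.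
  by apply: sub_infinite_set (SA 0).1 => m [].
by move=> i Di; rewrite -((AP (c i)).2 i).
Qed.

(** * Free ultrafilters *)

#[local] Instance omega_star_proper (U : omega_star) : ProperFilter (ultra U).
Proof. exact: (@ultra_proper _ _ (ultra_ultrafilter U)). Qed.

Lemma ultraC (U : omega_star) (A : set nat) : ultra U (~` A) <-> ~ ultra U A.
Proof.
split=> [UnA UA|nUA]; last first.
  by have [//|] := in_ultra_setVsetC A (ultra_ultrafilter U).
have : ultra U (A `&` ~` A) by exact: filterI.
by rewrite setICr => /filter_ex[].
Qed.

(** A nonprincipal ultrafilter contains the complement of each point, hence of each finite set. *)
Lemma omega_star_infinite (U : omega_star) (A : set nat) :
  ultra U A -> infinite_set A.
Proof.
move=> UA Afin.
have UC n : ultra U (~` [set n]).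
  apply/ultraC => Un; apply: (@ultra_nonprincipal U n).
  apply/seteqP; split=> B => [UB|/principal_filterP Bn].
    apply/principal_filterP.
    have : ultra U ([set n] `&` B) by exact: filterI.
    by move=> /filter_ex[_ [->]].
  by apply: filterS Un => _ ->.
have /finite_fsetP[F AF] := Afin.
have UI : ultra U (\bigcap_(n in A) ~` [set n]).
  by rewrite AF; apply: filter_bigI => n _; exact: UC.
have : ultra U (A `&` \bigcap_(n in A) ~` [set n]) by exact: filterI.
by move=> /filter_ex[n [An /(_ n An)]]; apply.
Qed.

(** The sets almost containing some [Y k] form a proper filter. It contains all cofinite sets, so
    any ultrafilter extending it is free. *)
Lemma exists_omega_star (Y : nat -> set nat) :
  (forall k, infinite_set (Y k)) ->
  (forall k l, k <= l -> Y l `<=` Y k) ->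
  exists U : omega_star, forall k, ultra U (Y k).
Proof.
move=> Yinf Ydecr.
pose F := [set A | exists k, finite_set (Y k `\` A)].
have FF : ProperFilter F.
  apply: Build_ProperFilter_ex => [A [k Afin]|].
    apply: contrapT => A0; apply: (Yinf k).
    apply: sub_finite_set Afin => n Yn; split=> // An.
    by apply: A0; exists n.
  split.
  - by exists 0; rewrite setDT.
  - move=> A B [k Ak] [l Bl]; exists (maxn k l).
    have : finite_set ((Y k `\` A) `|` (Y l `\` B)) by rewrite finite_setU.
    apply: sub_finite_set => n [Yn nAB].
    have [An|nAn] := pselect (A n); [right|left]; split=> //.
    + by apply: Ydecr Yn; exact: leq_maxr.
    + by move=> Bn; apply: nAB.
    + by apply: Ydecr Yn; exact: leq_maxl.
  - move=> A B AB [k Ak]; exists k; apply: sub_finite_set Ak => n [Yn nB].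
    by split=> // /AB.
have [U [UU FU]] := ultraFilterLemma FF.
have np n : U <> principal_filter n.
  move=> Un; have : U (~` [set n]).
    apply: FU; exists 0; apply: sub_finite_set (finite_set1 n) => m [_].
    exact: contrapT.
  by rewrite Un principal_filterP; apply.
exists (OmegaStar UU np) => k; apply: FU; exists k.
by rewrite setDv.
Qed.

Lemma exists_omega_star1 (A : set nat) :
  infinite_set A -> exists U : omega_star, ultra U A.
Proof.
move=> Ainf; have [U UA] :=
  @exists_omega_star (fun=> A) (fun=> Ainf) (fun _ _ _ => @subset_refl _ A).
by exists U; exact: UA 0.
Qed.

(** Ensures that the cardinals compared are not default values. A free ultrafilter selects each
    [X n] or its complement, and a diagonal sequence [a] is almost contained in all the selected
    sets. *)
Lemma sigma_reaping_infinite_set : sigma_reaping [set A | infinite_set A].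
Proof.
split=> // X _.
have [U _] := exists_omega_star1 infinite_nat.
pose Z n := if pselect (ultra U (X n)) then X n else ~` X n.
have UZ n : ultra U (Z n) by rewrite /Z; case: pselect => // nU; exact/ultraC.
pose Y n := \bigcap_(i in `I_n) Z i.
have UY n : ultra U (Y n).
  elim: n => [|n IH]; first by rewrite /Y II0 bigcap_set0; exact: filterT.
  rewrite /Y IIS bigcap_setU bigcap_set1; exact: filterI.
have /choice[a aP] : forall n, exists m, n <= m /\ Y n m.
  move=> n; have /omega_star_infinite/infinite_natP/(_ n)[m ? ?] := UY n.
  by exists m.
exists (range a).
  apply/infinite_natP => n; exists (a n); last by exists n.
  by have [] := aP n.
move=> n.
have : finite_set (range a `\` Z n).
  apply: (sub_finite_set _ (finite_image a (finite_II n.+1))).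
  move=> _ [[k _ <-] nZ]; exists k => //=; rewrite ltnNge; apply/negP => nk.
  by have [_ Yk] := aP k; apply: nZ; exact: Yk.
rewrite /Z; case: pselect => nU Zfin; first by left.
by right; move: Zfin; rewrite setDE setCK.
Qed.

(** Finite stages replace the intersection of all sections over [X], which may be empty. *)
Definition cap_sections (A : set (nat * nat)) (X : set nat) (k : nat) :=
  \bigcap_(n in X `&` `I_k) xsection A n.

Lemma cap_sections_decr (A : set (nat * nat)) (X : set nat) (k l : nat) :
  k <= l -> cap_sections A X l `<=` cap_sections A X k.
Proof.
by move=> kl m Am n [Xn nk]; apply: Am; split=> //=; exact: leq_trans kl.
Qed.

Lemma sub_cap_sections (A : set (nat * nat)) (X : set nat) (n : nat) :
  X n -> cap_sections A X n.+1 `<=` xsection A n.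
Proof. by move=> Xn m; apply; split=> /=. Qed.

Lemma ultra_cap_sections (V : omega_star) (A : set (nat * nat)) (X : set nat)
    (k : nat) :
  (forall n, X n -> ultra V (xsection A n)) -> ultra V (cap_sections A X k).
Proof.
move=> VA; elim: k => [|k IH].
  by rewrite /cap_sections II0 setI0 bigcap_set0; exact: filterT.
have [Xk|nXk] := pselect (X k).
  apply: filterS (filterI IH (VA _ Xk)) => m [Am Akm] n [Xn].
  rewrite /= ltnS leq_eqVlt => /orP[/eqP->//|nk].
  exact: Am.
apply: filterS IH => m Am n [Xn].
rewrite /= ltnS leq_eqVlt => /orP[/eqP nk|nk]; last exact: Am.
by rewrite nk in Xn.
Qed.

(** Centeredness makes the decreasing sets [cap_sections A X k] infinite, so some free ultrafilter
    contains them all; conversely, finite intersections of its members are infinite. *)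
Lemma NCposP (A : set (nat * nat)) : NCpos A <->
  exists2 X, infinite_set X &
    exists V : omega_star, forall n, X n -> ultra V (xsection A n).
Proof.
split=> [/existsNP[X /not_implyP[Xinf /contrapT Xc]]|].
  exists X => //.
  have [||V VA] := @exists_omega_star (cap_sections A X).
  - move=> k; have [[n XIn]|X0] := pselect (X `&` `I_k !=set0).
      have -> : cap_sections A X k =
        \bigcap_(B in xsection A @` (X `&` `I_k)) B by rewrite bigcap_image.
      apply: Xc.
      + by apply: finite_image; apply: sub_finite_set (finite_II k) => ? [].
      + by exists (xsection A n), n.
      + by apply: image_subset => ? [].
    (* Centeredness says nothing about the empty family, whose intersection is everything. *)
    have -> : cap_sections A X k = setT; last exact: infinite_nat.
    by apply/seteqP; split=> // m _ n XIn; exfalso; apply: X0; exists n.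
  - exact: cap_sections_decr.
  - by exists V => n Xn; apply: filterS (VA n.+1); exact: sub_cap_sections.
move=> [X Xinf [V VA]] /(_ X Xinf); apply=> F /finite_fsetP[G ->] _ FX.
apply: (@omega_star_infinite V); apply: filter_bigI => B BG.
by have [n Xn <-] := FX _ BG; exact: VA.
Qed.

Lemma NCposS (A B : set (nat * nat)) : A `<=` B -> NCpos A -> NCpos B.
Proof.
move=> AB /NCposP[X Xinf [V VA]]; apply/NCposP; exists X => //; exists V.
by move=> n /VA; apply: filterS; exact: le_xsection.
Qed.

(** * Clopen subsets of the square of omega^* *)

Lemma cluster_closed (T : topologicalType) (F : set_system T) (D : set T) p :
  closed D -> F D -> cluster F p -> D p.
Proof.
move=> cD FD Fp; rewrite (closure_id D).1// => N pN.
by have [q [Dq Nq]] := Fp _ _ FD pN; exists q.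
Qed.

Lemma starC (A : set nat) : ~` star A = star (~` A).
Proof. by apply/seteqP; split=> U /ultraC. Qed.

Lemma clopen_star (A : set nat) : clopen (star A).
Proof.
have ostar B : open (star B) by exists [set B] => //; rewrite bigcup_set1.
by split=> //; rewrite -(setCK (star A)); apply: open_closedC; rewrite starC.
Qed.

Lemma nbhs_star (U : omega_star) (N : set omega_star) : nbhs U N ->
  exists2 A, ultra U A & star A `<=` N.
Proof.
rewrite nbhsE => -[_ [[D _ <-] [A DA UA]] DN]; exists A => // V VA.
by apply: DN; exists A.
Qed.

(** An ultrafilter [F] on the space converges to the ultrafilter of those [A] with [star A] in [F];
    it is free because [star] of a singleton is empty. *)
Lemma compact_omega_star : compact [set: omega_star].
Proof.
rewrite compact_ultra => F FU _.
have FF : ProperFilter F by exact: ultra_proper.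
pose G := [set A | F (star A)].
have GF : ProperFilter G.
  apply: Build_ProperFilter_ex.
    move=> A; rewrite /G /= => /filter_ex[U UA].
    exact: filter_ex UA.
  split.
  - apply: (@filterS _ F _ setT); last exact: filterT.
    by move=> U _; exact: filterT.
  - move=> A B FA FB; apply: (@filterS _ F _ (star A `&` star B)).
      by move=> U [UA UB]; exact: filterI.
    exact: filterI.
  - by move=> A B AB; apply: (@filterS _ F) => U; exact: filterS.
have GU : UltraFilter G.
  split=> // H HH GH; apply/seteqP; split=> // A HA.
  have [//|] := in_ultra_setVsetC (star A) FU.
  rewrite starC => /GH HnA; have : H (A `&` ~` A) by exact: filterI.
  by rewrite setICr => /filter_ex[].
have Gnp n : G <> principal_filter n.
  move=> Gn; have : G [set n] by rewrite Gn; exact/principal_filterP.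
  rewrite /G /= => /filter_ex[U Un].
  exact: (omega_star_infinite Un) (finite_set1 n).
exists (OmegaStar GU Gnp); split=> // N /nbhs_star[A GA AN].
exact: (@filterS _ F _ (star A)).
Qed.

(** * Boxes and iterated products of ultrafilters *)

Definition box (S T : set nat) : set (omega_star * omega_star) :=
  star S `*` star T.

Lemma clopen_box (S T : set nat) : clopen (box S T).
Proof.
have -> : box S T = (fst @^-1` star S) `&` (snd @^-1` star T) by [].
apply: clopenI; apply: preimage_clopen; try exact: clopen_star.
  by move=> p; exact: cvg_fst.
by move=> p; exact: cvg_snd.
Qed.

Lemma nbhs_box (p : omega_star * omega_star)
    (N : set (omega_star * omega_star)) :
  nbhs p N -> exists S T, box S T p /\ box S T `<=` N.
Proof.
move=> [[M1 M2] /= [/nbhs_star[S p1S SM] /nbhs_star[T p2T TM]] MN].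
by exists S, T; split=> // q [/SM ? /TM ?]; exact: MN.
Qed.

Lemma box_nonempty (S T : set nat) :
  infinite_set S -> infinite_set T -> box S T !=set0.
Proof.
by move=> /exists_omega_star1[U US] /exists_omega_star1[V VT]; exists (U, V).
Qed.

(* Membership of [A] in the iterated product of the two ultrafilters; on
   rectangles this is membership in a box, see [fubini_setX]. *)
Definition fubini (p : omega_star * omega_star) (A : set (nat * nat)) : Prop :=
  ultra p.1 [set n | ultra p.2 (xsection A n)].

Lemma fubiniS p (A B : set (nat * nat)) : A `<=` B -> fubini p A -> fubini p B.
Proof.
move=> AB; rewrite /fubini; apply: filterS => n /=.
by apply: filterS; exact: le_xsection.
Qed.

Lemma fubiniC p (A : set (nat * nat)) : fubini p (~` A) <-> ~ fubini p A.
Proof.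
rewrite -ultraC /fubini; suff -> : [set n | ultra p.2 (xsection (~` A) n)] =
  ~` [set n | ultra p.2 (xsection A n)] by [].
apply/seteqP; split=> n /=; rewrite -ultraC; apply: filterS => m.
  by move=> /xsectionP nA /xsectionP.
by move=> nA; apply/xsectionP => nAm; apply: nA; apply/xsectionP.
Qed.

Lemma fubiniI p (A B : set (nat * nat)) :
  fubini p A -> fubini p B -> fubini p (A `&` B).
Proof.
rewrite /fubini => pA pB.
have : ultra p.1 ([set n | ultra p.2 (xsection A n)] `&`
    [set n | ultra p.2 (xsection B n)]) by exact: filterI.
by apply: filterS => n [nA nB] /=; rewrite xsectionI; exact: filterI.
Qed.

Lemma fubiniU p (A B : set (nat * nat)) :
  fubini p (A `|` B) -> fubini p A \/ fubini p B.
Proof.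
move=> pAB; apply: contrapT => /not_orP[/fubiniC nA /fubiniC nB].
have := fubiniI nA nB; rewrite -setCU => /fubiniC; exact.
Qed.

Lemma fubini_setX p (S T : set nat) : fubini p (S `*` T) <-> box S T p.
Proof.
rewrite /fubini; split=> [pST|[pS pT]].
  split.
    by apply: filterS pST => n /filter_ex[m]; rewrite xsectionP => -[].
  have /filter_ex[n /=] := pST.
  by apply: filterS => m; rewrite xsectionP => -[].
by apply: filterS pS => n Sn; apply: filterS pT => m Tm; apply/xsectionP.
Qed.

Lemma fubini0 p : ~ fubini p set0.
Proof.
by rewrite /fubini => /filter_ex[n]; rewrite /= xsection0 => /filter_ex[].
Qed.

Lemma compact_omega_star2 : compact [set: omega_star * omega_star].
Proof.
by rewrite -setXTT; apply: compact_setX; exact: compact_omega_star.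
Qed.

Lemma clopen_fubini (C : set (omega_star * omega_star)) : clopen C ->
  exists A, forall p, C p <-> fubini p A.
Proof.
move=> [oC cC].
pose good A := forall p, fubini p A -> C p.
(* If [C] is not a finite union of boxes, the complements of such unions
   generate a proper filter on [C]; it has no cluster point in [C]. *)
pose F := [set D | exists2 A, good A & forall p, C p -> D p \/ fubini p A].
have [[A Agood CA]|F0] := pselect (F set0).
  by exists A => p; split=> [/CA[]//|]; exact: Agood.
have FF : ProperFilter F.
  split=> //; split.
  - by exists set0 => [p /fubini0//|p _]; left.
  - move=> D E [A Ag CA] [B Bg CB]; exists (A `|` B).
      by move=> p /fubiniU[/Ag|/Bg].
    move=> p Cp; have [Dp|pA] := CA _ Cp; last first.
      by right; apply: fubiniS pA; exact: subsetUl.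
    have [Ep|pB] := CB _ Cp; first by left.
    by right; apply: fubiniS pB; exact: subsetUr.
  - move=> D E DE [A Ag CA]; exists A => // p /CA[/DE|]; [by left|by right].
have FC : F C by exists set0 => [p /fubini0//|p]; left.
have [p [_ Fp]] := compact_omega_star2 FF filterT.
have Cp : C p by exact: cluster_closed Fp.
have /nbhs_box[S [T [pST STC]]] : nbhs p C by exact: open_nbhs_nbhs.
(* The rectangle on [S] and [T] is good, so the complement of its box is in [F]; being closed, it
   would contain the cluster point [p]. *)
suff /(_ pST) : (~` box S T) p by [].
apply: cluster_closed Fp.
  by apply: open_closedC; exact: (clopen_box S T).1.
exists (S `*` T) => [q /fubini_setX/STC//|q _].
by have [qST|] := pselect (box S T q); [right; apply/fubini_setX|left].
Qed.

(** * Comparison of the reaping numbers *)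

(** Nonemptiness is passed on together with the inequality, since [least_size] is meaningful only
    for nonempty [W]. *)
Lemma least_size_le (T U : Type) (W : set (set T)) (W' : set (set U)) :
  (forall R, W R -> exists2 R', W' R' & R' #<= R) ->
  W !=set0 -> W' !=set0 /\ least_size W' #<= least_size W.
Proof.
move=> WW' /least_sizeP[WR _]; have [R' WR' le] := WW' _ WR.
have W'0 : W' !=set0 by exists R'.
split=> //; have [_ min] := least_sizeP W'0.
exact: card_le_trans (min _ WR') le.
Qed.

Lemma reaping_of_reaping2 (R : set (set (omega_star * omega_star))) :
  reaping2 R -> exists2 R', reaping R' & R' #<= R.
Proof.
move=> [Rclopen Rreap].
have /choice[X XP] : forall A, exists X, R A ->
    infinite_set X /\ exists2 Y, infinite_set Y & box X Y `<=` A.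
  move=> A; have [RA|nRA] := pselect (R A); last by exists setT.
  have [[oA _] /eqP/set0P[p Ap]] := Rclopen _ RA.
  have /nbhs_box[X [Y [[pX pY] XYA]]] : nbhs p A by exact: open_nbhs_nbhs.
  exists X => _; split; first exact: omega_star_infinite pX.
  by exists Y => //; exact: omega_star_infinite pY.
exists (X @` R); last exact: card_image_le.
split=> [_ [A RA <-]|[S _ Ssplits]]; first by have [] := XP _ RA.
apply: Rreap; exists (box S setT); first exact: clopen_box.
move=> A RA; have [_ [Y Yinf XYA]] := XP _ RA.
have [XS XnS] : splits S (X A) by apply: Ssplits; exists A.
split; apply/eqP/set0P.
- have [p [pX pY]] := box_nonempty XS Yinf; exists p; split.
    by apply: XYA; split=> //; apply: filterS pX => ? [].
  by split; [apply: filterS pX => ? []|exact: filterT].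
- have [p [pX pY]] := box_nonempty XnS Yinf; exists p; split.
    by apply: XYA; split=> //; apply: filterS pX => ? [].
  suff /ultraC nS : ultra p.1 (~` S) by move=> [].
  by apply: filterS pX => ? [].
Qed.

Lemma NCpos_choice (R : set (set (nat * nat))) : R `<=` NCpos ->
  exists X : set (nat * nat) -> set nat, forall B, R B -> infinite_set (X B) /\
    exists V : omega_star, forall n, X B n -> ultra V (xsection B n).
Proof.
move=> Rpos.
have /choice[X XP] : forall B, exists X, R B -> infinite_set X /\
    exists V : omega_star, forall n, X n -> ultra V (xsection B n).
  move=> B; have [/Rpos/NCposP[X Xinf XV]|nRB] := pselect (R B).
    by exists X.
  by exists setT.
by exists X.
Qed.

(** Finitely many index sets [X B] are split by one [S], and the strip over [S] then splits every
    [B]. *)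
Lemma NC_reaping_infinite (R : set (set (nat * nat))) :
  NC_reaping R -> infinite_set R.
Proof.
move=> [Rpos Rreap] Rfin; apply: Rreap.
have [X XP] := NCpos_choice Rpos.
have [|S Sinf SX] := exists_splitting (X := X) Rfin.
  by move=> B /XP[].
exists (S `*` setT).
  have [V _] := exists_omega_star1 infinite_nat.
  apply/NCposP; exists S => //; exists V => n Sn.
  by rewrite in_xsectionX ?inE//; exact: filterT.
move=> B RB; have [_ [V VB]] := XP _ RB; have [XS XnS] := SX _ RB.
split; apply/NCposP.
- exists (X B `&` S) => //; exists V => n [Xn Sn].
  by rewrite xsectionI in_xsectionX ?inE// setTI; exact: VB.
- exists (X B `\` S) => //; exists V => n [Xn nSn].
  by rewrite xsectionD notin_xsectionX ?setD0 ?notin_setE//; exact: VB.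
Qed.

Lemma reaping2_of_NC_reaping (R : set (set (nat * nat))) :
  NC_reaping R -> exists2 R', reaping2 R' & R' #<= R.
Proof.
move=> Rr; have Rinf := NC_reaping_infinite Rr; have [Rpos Rreap] := Rr.
have [X XP] := NCpos_choice Rpos.
pose r (q : set (nat * nat) * nat) :=
  box (X q.1) (cap_sections q.1 (X q.1) q.2).
exists (r @` (R `*` setT)); last first.
  apply: card_le_trans (card_image_le _ _) _.
  (* An embedding of [nat] into the infinite [R] turns the countably many boxes per set into pairs
     from [R]. *)
  apply: card_le_trans (card_le_square Rinf).
  have [B0 _] := infinite_setN0 Rinf.
  have /infiniteP/(inj_of_card_le B0)[g [gR ginj]] := Rinf.
  apply: (@card_le_of_inj _ _ _ _ (fun q => (q.1, g q.2))).
    by move=> [B k] [RB _]; split=> //; exact: gR.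
  by move=> [B k] [C l] _ _ [-> /ginj->].
split.
  move=> _ [[B k] [RB _] <-]; split; first exact: clopen_box.
  apply/eqP/set0P; have [Xinf [V VB]] := XP _ RB.
  have [U UX] := exists_omega_star1 Xinf.
  by exists (U, V); split=> //; exact: ultra_cap_sections.
move=> [C Cclopen Csplits]; apply: Rreap.
have [A CA] := clopen_fubini Cclopen.
(* A cluster point of points of [r (B, k) `&` D] decides [D] and contains
   every section of [B] over [X B]. *)
have pos B D E : R B -> closed D -> (forall p, D p -> fubini p E) ->
    (forall k, r (B, k) `&` D !=set0) -> NCpos (B `&` E).
  move=> RB cD DE /choice[p pP].
  have [q [_ Fq]] := compact_omega_star2
    (fmap_proper_filter p eventually_filter) filterT.
  have qD : D q.
    apply: cluster_closed Fq => //; exists 0 => // k _.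
    exact: (pP k).2.
  (* The boxes decrease with [k], so the points [p l] with [l >= k] all lie in the closed set
     [r (B, k)]. *)
  have qB k : r (B, k) q.
    apply: cluster_closed Fq => //; first exact: (clopen_box _ _).2.
    exists k => // l /= kl; have [[pX pB] _] := pP l.
    by split=> //; apply: filterS pB; exact: cap_sections_decr.
  (* This index set belongs to [q.1], hence is infinite, and [q.2] contains the sections of both [B]
     and [E] over it. *)
  apply/NCposP; exists (X B `&` [set n | ultra q.2 (xsection E n)]).
    apply: (@omega_star_infinite q.1); apply: filterI; last exact: DE.
    exact: (qB 0).1.
  exists q.2 => n [Xn En]; rewrite xsectionI; apply: filterI => //.
  by apply: filterS (qB n.+1).2; exact: sub_cap_sections.
have posI B : R B -> NCpos (B `&` A).
  move=> RB; apply: (@pos _ C) => //; [exact: Cclopen.2|by move=> p /CA|].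
  move=> k; apply/set0P/eqP; apply: (Csplits _ _).1.
  by exists (B, k).
have posD B : R B -> NCpos (B `\` A).
  move=> RB; rewrite setDE; apply: (@pos _ (~` C)) => //.
  - by apply: open_closedC; exact: Cclopen.1.
  - by move=> p nCp; apply/fubiniC => /CA.
  - move=> k; apply/set0P/eqP; apply: (Csplits _ _).2.
    by exists (B, k).
exists A.
  have [B RB] := infinite_setN0 Rinf.
  by apply: NCposS (posI _ RB); exact: subIsetr.
by move=> B RB; split; [rewrite setIC; exact: posI|exact: posD].
Qed.

(** One set splits all members of a finite family, so the constant sequence at that set refutes
    sigma-reaping. *)
Lemma sigma_reaping_infinite (R : set (set nat)) :
  sigma_reaping R -> infinite_set R.
Proof.
move=> [Rinf Rsigma] Rfin.
have [|S Sinf SR] := exists_splitting (X := id) Rfin; first exact: Rinf.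
have [A RA AS] := Rsigma (fun=> S) (fun=> Sinf).
by have [AI AD] := SR _ RA; have [/AD|/AI] := AS 0.
Qed.

Lemma NCpos_section_infinite (A : set (nat * nat)) : NCpos A ->
  exists2 X, infinite_set X & forall n, X n -> infinite_set (xsection A n).
Proof.
move=> /NCposP[X Xinf [V VA]]; exists X => // n /VA.
exact: omega_star_infinite.
Qed.

(** Sections may be finite, whereas [sigma_reaping] speaks of infinite sets only; a finite [Y n] is
    decided by every [A] and can be replaced by [setT]. *)
Lemma sigma_reaping_decides (R : set (set nat)) (Y : nat -> set nat) :
  sigma_reaping R -> exists2 A, R A &
    forall n, almost_subset A (Y n) \/ finite_set (A `&` Y n).
Proof.
move=> [Rinf Rsigma].
pose Z n := if pselect (finite_set (Y n)) then setT else Y n.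
have [n|A RA AZ] := Rsigma Z.
  rewrite /Z; case: pselect => [Yfin|//]; exact: infinite_nat.
exists A => // n; have := AZ n; rewrite /Z; case: pselect => [Yfin ?|//].
by right; apply: sub_finite_set (Yfin) => ? [].
Qed.

Lemma NC_reaping_of_sigma_reaping (R : set (set nat)) :
  sigma_reaping R -> exists2 R', NC_reaping R' & R' #<= R.
Proof.
move=> Rs; have [Rinf _] := Rs.
exists ((fun p => p.1 `*` p.2) @` (R `*` R)); last first.
  apply: card_le_trans (card_image_le _ _) _.
  exact: card_le_square (sigma_reaping_infinite Rs).
split.
  move=> _ [[S T] [RS RT] <-] /=; apply/NCposP; exists S; first exact: Rinf.
  have [V VT] := exists_omega_star1 (Rinf _ RT).
  by exists V => n Sn; rewrite in_xsectionX ?inE.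
move=> [C _ Csplits].
have [T RT TC] := sigma_reaping_decides (xsection C) Rs.
pose Z := [set n | almost_subset T (xsection C n)].
have [S RS SZ] := sigma_reaping_decides (fun=> Z) Rs.
have [] : NC_splits C (S `*` T) by apply: Csplits; exists (S, T).
move=> /NCpos_section_infinite[X Xinf XI] /NCpos_section_infinite[Y Yinf YD].
have [SZfin|SZfin] := SZ 0.
(* Over [n] in both [S] and [Z], the section of the rectangle minus [C] is finite, so [Y] lies in
   the finite part of [S] outside [Z]. *)
- apply: Yinf; apply: sub_finite_set SZfin => n /YD; rewrite xsectionD => nD.
  have [Sn|nSn] := pselect (S n); last first.
    by exfalso; apply: nD; rewrite notin_xsectionX ?notin_setE// set0D.
  by split=> // Zn; apply: nD; rewrite in_xsectionX ?inE.
(* Dually, for [n] in [S] outside [Z] the set [T] meets the section of [C] finitely, so [X] lies in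
   the finite set of points common to [S] and [Z]. *)
- apply: Xinf; apply: sub_finite_set SZfin => n /XI; rewrite xsectionI => nI.
  have [Sn|nSn] := pselect (S n); last first.
    by exfalso; apply: nI; rewrite notin_xsectionX ?notin_setE// setI0.
  split=> //; have [//|TCfin] := TC n.
  by exfalso; apply: nI; rewrite in_xsectionX ?inE// setIC.
Qed.

Theorem theorem2p5 :
  [/\ reaping_number #<= reaping2_number,
      reaping2_number #<= NC_reaping_number &
      NC_reaping_number #<= sigma_reaping_number].
Proof.
have sigma0 : sigma_reaping !=set0.
  by exists [set A | infinite_set A]; exact: sigma_reaping_infinite_set.
have [NC0 le3] := least_size_le NC_reaping_of_sigma_reaping sigma0.
have [r20 le2] := least_size_le reaping2_of_NC_reaping NC0.
by have [_ le1] := least_size_le reaping_of_reaping2 r20.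
Qed.
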